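(* Fix an integer $n\ge 1$. For a prime $q$, let $S\subseteq M_n(\mathbb{F}_q)$ be a uniformly random subset (each of the $2^{q^{n^2}}$ subsets being equally likely). Then, as $q\to\infty$ through the primes, $$\lim_{q\to\infty}\mathbb{P}(S\text{ is a pure core set})=\lim_{q\to\infty}\mathbb{P}(S\text{ is a core set})=1.$$
   Context: $M_n(F)$ is the ring of $n\times n$ matrices over a field $F$; a similarity class is an orbit of $M_n(F)$ under conjugation by $\mathrm{GL}(n,F)$. In $M_n(F)[x]$ the indeterminate $x$ commutes with all coefficients. Evaluation is with $x$ to the right of the coefficients: for $f=\sum_k B_kx^k$ and $A\in M_n(F)$, $f(A)=\sum_k B_kA^k$. For $S\subseteq M_n(F)$, $N(S)=\{f\in M_n(F)[x] : f(A)=0\ \text{for all } A\in S\}$. $S$ is a core set if $N(S)$ is a two-sided ideal of $M_n(F)[x]$ (in particular $\varnothing$ is a core set). $S$ is a pure core set if $S\cap\mathcal{C}$ is a core set for every similarity class $\mathcal{C}$ of $M_n(F)$. *)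

(* Defs.v *)
From HB Require Import structures.
From mathcomp Require Import all_boot all_order all_algebra.
From mathcomp Require Import all_classical all_reals all_analysis.

Set Implicit Arguments.
Unset Strict Implicit.
Unset Printing Implicit Defensive.

Import Order.TTheory GRing.Theory Num.Theory.
Import numFieldNormedType.Exports.

Local Open Scope classical_set_scope.
Local Open Scope ring_scope.

(* Not necessarily proper: the whole ring is a two-sided ideal. *)
Definition two_sided_ideal (R : nzRingType) (I : set R) : Prop :=
  [/\ I 0,
      forall f g, I f -> I g -> I (f - g)
    & forall f g, I f -> I (g * f) /\ I (f * g)].

(* Matrices of size n.+1 are used throughout: 'M[F]_n.+1 is MathComp's
   (nontrivial) ring of square matrices, over which {poly _} is defined. *)

(* In {poly R} over a noncommutative ring R, 'X commutes with constants, and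
   f.[A] = \sum_i f`_i * A ^+ i, with coefficients on the left (horner_coef). *)
Definition null_polys (F : fieldType) (n : nat) (S : set 'M[F]_n.+1) :
    set {poly 'M[F]_n.+1} :=
  [set f | forall A, S A -> f.[A] = 0].

Definition core_set (F : fieldType) (n : nat) (S : set 'M[F]_n.+1) : Prop :=
  two_sided_ideal (null_polys S).

Definition similarity_class (F : fieldType) (n : nat) (A : 'M[F]_n.+1) :
    set 'M[F]_n.+1 :=
  [set B | exists2 P : 'M[F]_n.+1, P \in unitmx & B = P *m A *m invmx P].

Definition pure_core_set (F : fieldType) (n : nat) (S : set 'M[F]_n.+1) :
    Prop :=
  forall A : 'M[F]_n.+1, core_set (S `&` similarity_class A).

(* Probability of the event E for a uniformly random subset of T. *)
Definition prob_random_subset (R : realType) (T : finType)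
    (E : set T -> Prop) : R :=
  #|[pred S : {set T} | `[< E [set` S] >]]|%:R / #|{set T}|%:R.

(* Main.v *)
Require Import Defs.
From HB Require Import structures.
From mathcomp Require Import all_boot all_order all_algebra.
From mathcomp Require Import all_classical all_reals all_analysis.

Set Implicit Arguments.
Unset Strict Implicit.
Unset Printing Implicit Defensive.

Import Order.TTheory GRing.Theory Num.Theory.
Import numFieldNormedType.Exports.

Local Open Scope classical_set_scope.
Local Open Scope ring_scope.

(* The null polynomials of [S] always form a left ideal; they are closed under
   right multiplication by constants as soon as they vanish on every conjugate
   of an element of [S].  Hence [S] can fail to be a pure core set only if, for
   some nonscalar [A] and some [f] with [f(A) <> 0], the set [S] misses every
   conjugate [B] of [A] with [f(B) <> 0].  By Cayley-Hamilton one may take [f]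
   of degree less than the matrix size [m], so there are at most
   [q ^ (m ^ 2 + m ^ 3)] pairs [(A, f)]; for each pair at least [q - 1]
   conjugates have to be missed, which has probability at most [2 ^ (1 - q)],
   and the union bound tends to 0.  Finally, a pure core set is a core set
   because its null ideal is the intersection of those of its similarity
   slices. *)

(** * Evaluation of polynomials with noncommuting coefficients *)

Lemma horner_mul_eq0 (A : nzRingType) (g f : {poly A}) (a : A) :
  f.[a] = 0 -> (g * f).[a] = 0.
Proof.
move=> /rootP/factor_theorem[q ->].
by apply/rootP/factor_theorem; exists (g * q); rewrite mulrA.
Qed.

(** Induction on [f], moving [u] past one power of [a] at a time. No inverse of [u] appears, so
    scalar [u], zero included, are covered with [b = a]. *)
Lemma hornerMC_intertwine (A : nzRingType) (f : {poly A}) (a b u : A) :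
  u * a = b * u -> (f * u%:P).[a] = f.[b] * u.
Proof.
move=> uab; elim/poly_ind: f => [|p c IH]; first by rewrite mul0r !horner0 mul0r.
rewrite mulrDl -mulrA -commr_polyX mulrA -polyCM !hornerMXaddC IH mulrDl.
by rewrite -!mulrA uab.
Qed.

(** * Similarity classes and a hitting criterion for pure core sets *)

Section Similarity.
Context (F : finFieldType) (n : nat).
Implicit Types A B C E : 'M[F]_n.+1.
Implicit Types (f g : {poly 'M[F]_n.+1}) (S : set 'M[F]_n.+1).

Lemma similarity_class_refl A : similarity_class A A.
Proof. by exists 1%:M; rewrite ?unitmx1// invmx1 mul1mx mulmx1. Qed.

Lemma similarity_class_sym A B : similarity_class A B -> similarity_class B A.
Proof.
case=> P Pu ->; exists (invmx P); first by rewrite unitmx_inv.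
by rewrite invmxK -!mulmxA mulVmx// mulmx1 mulKmx.
Qed.

Lemma similarity_class_trans A B C :
  similarity_class A B -> similarity_class B C -> similarity_class A C.
Proof.
move=> [P Pu ->] [Q Qu ->]; exists (Q *m P); first by rewrite unitmx_mul Qu.
by rewrite -[invmx (Q *m P)]/((Q * P)^-1) invrM// -!mulmxE !mulmxA.
Qed.

(** For [i != j], comparing the entries [(j, j)] and [(i, j)] of the two products gives [A j i = 0]
    and [A i i = A j j]. Off-diagonal units are the ones that square to zero and so yield
    transvections. *)
Lemma delta_mx_comm_scalar A :
  (forall i j, i != j -> delta_mx i j *m A = A *m delta_mx i j) ->
  is_scalar_mx A.
Proof.
move=> cA.
have mul_deltal i j k l : (delta_mx i j *m A) k l = A j l *+ (k == i).
  rewrite mxE (bigD1 j)//= big1 => [|m mj].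
    by rewrite mxE eqxx andbT addr0 mulr_natl.
  by rewrite mxE (negbTE mj) andbF mul0r.
have mul_deltar i j k l : (A *m delta_mx i j) k l = A k i *+ (l == j).
  rewrite mxE (bigD1 i)//= big1 => [|m mi].
    by rewrite mxE eqxx addr0 mulr_natr.
  by rewrite mxE (negbTE mi) mulr0.
have comm i j k l : i != j -> A j l *+ (k == i) = A k i *+ (l == j).
  by move=> ij; rewrite -mul_deltal cA// mul_deltar.
have off i j : i != j -> A j i = 0.
  by move=> ij; have := comm _ _ j j ij; rewrite eqxx [j == i]eq_sym (negbTE ij).
have diag i j : i != j -> A i i = A j j.
  by move=> ij; have := comm _ _ i j ij; rewrite !eqxx.
apply/is_scalar_mxP; exists (A ord0 ord0); apply/matrixP => i j.
rewrite mxE; have [->|ij] := eqVneq i j; last first.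
  by rewrite mulr0n off// eq_sym.
by rewrite mulr1n; have [->//|/diag] := eqVneq j ord0.
Qed.

(* Conjugation by the transvections [1 + t e_ij] for [e_ij] not commuting with
   [A]: the value of [f] there is, up to a unit, affine in [t] and nonzero at
   [t = 0], so it vanishes for at most one [t]. *)
Lemma card_similarity_nonvanishing A f :
  ~~ is_scalar_mx A -> f.[A] != 0 ->
  (#|F|.-1 <= #|[set B : 'M[F]_n.+1 | `[< similarity_class A B >]
                                       & (f.[B] != 0)%R]%SET|)%N.
Proof.
move=> nsA fA.
have [i [j [ij nc]]] :
    exists i j, i != j /\ delta_mx i j *m A != A *m delta_mx i j.
  apply: contrapT => h; move/negP: nsA; apply; apply: delta_mx_comm_scalar.
  move=> i j ij; apply: contrapT => /eqP nc; apply: h; exists i, j; split => //.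
set e : 'M[F]_n.+1 := delta_mx i j in nc.
have ee : e * e = 0 by apply: mul_delta_mx_0; rewrite eq_sym.
pose T t : 'M[F]_n.+1 := 1 + t *: e.
have TD s t : T s * T t = T (s + t).
  rewrite /T mulrDl mul1r mulrDr mulr1 -scalerAl -scalerAr ee !scaler0 addr0.
  by rewrite scalerDl -addrA [t *: e + _]addrC.
have TV t : T t * T (- t) = 1 by rewrite TD subrr /T scale0r addr0.
have TVl t : T (- t) * T t = 1 by rewrite TD addNr /T scale0r addr0.
pose c t := T t * A * T (- t).
have cS t : similarity_class A (c t).
  have Tu : T t \in unitmx by apply/unitrP; exists (T (- t)).
  exists (T t) => //.
  have -> : invmx (T t) = T (- t); last by [].
  by rewrite -[LHS]mulr1 -(TV t) mulrA [invmx _ * _]mulVmx// mul1r.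
have cT t : c t * T t = T t * A by rewrite /c -[LHS]mulrA TVl mulr1.
have fc t : f.[c t] * T t = f.[A] + t *: (f * e%:P).[A].
  rewrite -(hornerMC_intertwine f (a := A)); last by rewrite cT.
  rewrite /T polyCD mulrDr mulr1 hornerD; congr (_ + _).
  rewrite -!mul_mx_scalar !mulmxE polyCM mulrA.
  by rewrite (hornerMC_intertwine _ (b := A))//; rewrite -[LHS]scalar_mxC.
have fc_uniq s t : f.[c s] = 0 -> f.[c t] = 0 -> s = t.
  move=> fs ft; apply/eqP; rewrite -subr_eq0; apply/negPn/negP => st.
  have := fc s; have := fc t; rewrite fs ft !mul0r => ht hs.
  have : (s - t) *: (f * e%:P).[A] = 0.
    have /= := congr2 (fun x y => x - y) hs ht.
    by rewrite subrr opprD addrACA subrr add0r scalerBl => <-.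
  move/eqP; rewrite scaler_eq0 (negbTE st)/= => /eqP z.
  by move: ht; rewrite z scaler0 addr0 => fA0; rewrite -fA0 eqxx in fA.
(* If [c s = c t], then [T (s - t)] commutes with [A]; for [s != t] so would [e]. *)
have c_inj : injective c.
  move=> s t cst; apply/eqP; rewrite -subr_eq0; apply/negPn/negP => st.
  have : T (s - t) * A = A * T (s - t).
    rewrite [s - t]addrC -TD -mulrA -cT cst mulrA.
    by rewrite /c !mulrA TVl mul1r.
  rewrite /T mulrDl mulrDr mul1r mulr1 => /addrI.
  rewrite -scalerAl -scalerAr => /(scalerI st) ecA.
  by rewrite -[_ *m _]/(e * A) ecA eqxx in nc.
pose D := [set t : F | f.[c t] != 0]%SET.
have cardD : (#|F|.-1 <= #|D|)%N.
  have [[t0 ft0]|noz] := pselect (exists t, f.[c t] = 0); last first.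
    rewrite (leq_trans (leq_pred _))// -cardsT subset_leq_card//.
    apply/fintype.subsetP => t _; rewrite inE.
    by apply/eqP => ft; apply: noz; exists t.
  rewrite -cardsT (cardsD1 t0) inE/= subset_leq_card//.
  apply/fintype.subsetP => t; rewrite !inE andbT; apply: contra => /eqP ft.
  by apply/eqP; exact: fc_uniq.
apply: leq_trans cardD _; rewrite -(card_imset _ c_inj) subset_leq_card//.
apply/fintype.subsetP => _ /imsetP[t tD ->]; rewrite !inE in tD *.
by rewrite tD andbT; apply/asboolP.
Qed.

(** The remainder modulo the characteristic polynomial of [A] serves the whole class, since that
    polynomial kills every conjugate of [A]. *)
Lemma horner_similarity_reduce A f :
  exists2 r : {poly 'M[F]_n.+1}, (size r <= n.+1)%N &
    forall B, similarity_class A B -> f.[B] = r.[B].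
Proof.
pose p : {poly 'M[F]_n.+1} := map_poly scalar_mx (char_poly A).
have pm : p \is monic by apply: monic_map; exact: char_poly_monic.
exists (Pdiv.CommonRing.rmodp f p) => [|B [P Pu BE]].
  rewrite -ltnS -(size_char_poly A) -(size_map_poly (@scalar_mx F n.+1) (char_poly A)).
  by apply: Pdiv.CommonRing.ltn_rmodpN0; exact: monic_neq0.
rewrite [in LHS](Pdiv.RingMonic.rdivp_eq pm f) hornerD horner_mul_eq0 ?add0r//.
rewrite -[_.[B]]/(horner_mx B (char_poly A)) BE horner_mx_uconj//.
by rewrite Cayley_Hamilton mulmx0 mul0mx.
Qed.

(** A bad [c] is an eigenvalue of [C], and there are at most [n.+1] of these. This makes every
    constant a unit plus a scalar. *)
Lemma exists_unit_shift C : (n.+1 < #|F|)%N -> exists c, C - c%:M \in unitmx.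
Proof.
move=> nF; apply: contrapT => noc.
suff : (size (enum F) < size (char_poly C))%N.
  by rewrite -cardE size_char_poly ltnS leqNgt nF.
apply: max_poly_roots; last exact: enum_uniq.
  by rewrite monic_neq0// char_poly_monic.
apply/allP => c _; rewrite -eigenvalue_root_char /eigenvalue kermx_eq0.
by rewrite row_free_unit; apply/negP => cu; apply: noc; exists c.
Qed.

Lemma pure_core_set_hitting S :
  (n.+1 < #|F|)%N ->
  (forall A f, (size f <= n.+1)%N -> ~~ is_scalar_mx A -> f.[A] != 0 ->
     exists2 B, (S `&` similarity_class A) B & f.[B] != 0) ->
  pure_core_set S.
Proof.
move=> nF hit A; split=> [B _|f g f0 g0 B SB|f g f0].
- by rewrite horner0.
- by rewrite hornerD hornerN f0// g0// subrr.
split=> B SB; first by apply: horner_mul_eq0; exact: f0.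
(* The hitting hypothesis says nothing about scalar [B], but evaluation at a central element is
   multiplicative. *)
have [/is_scalar_mxP[b Bb]|nsB] := boolP (is_scalar_mx B).
  rewrite hornerM_comm ?f0 ?mul0r//.
  by rewrite /comm_poly Bb -[LHS]scalar_mxC.
have f0A B' : similarity_class A B' -> f.[B'] = 0.
  move=> AB'; apply: contrapT => /eqP fB'.
  have nsB' : ~~ is_scalar_mx B'.
    apply: contra nsB => /is_scalar_mxP[b B'b].
    have [P Pu ->] := similarity_class_trans (similarity_class_sym AB') SB.2.
    by rewrite B'b scalar_mxC mulmxK// scalar_mx_is_scalar.
  have [r sz_r fr] := horner_similarity_reduce A f.
  have [D [SD B'D]] : exists2 D, (S `&` similarity_class B') D & r.[D] != 0.
    by apply: hit; rewrite -?fr.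
  have AD := similarity_class_trans AB' B'D.
  by rewrite -fr// f0 ?eqxx.
(* Write [C = U + c] with [U] a unit: [f * U] at [B] is [f] at a conjugate of [B], times [U], and
   the scalar part gives [f.[B]] times [c]. *)
have fC0 C : (f * C%:P).[B] = 0.
  have [c Cu] := exists_unit_shift C nF.
  rewrite -[C](subrK c%:M) polyCD mulrDr hornerD.
  rewrite (hornerMC_intertwine f (b := (C - c%:M) *m B *m invmx (C - c%:M)));
    last first.
    by rewrite -[_ * (C - _)]/(_ *m (C - _)) mulmxKV.
  rewrite f0A ?mul0r ?add0r; last first.
    by apply: similarity_class_trans SB.2 _; exists (C - c%:M).
  rewrite (hornerMC_intertwine f (b := B)) ?f0 ?mul0r//.
  by rewrite -[LHS]scalar_mxC.
elim/poly_ind: g => [|g C IH]; first by rewrite mulr0 horner0.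
by rewrite mulrDr mulrA hornerD hornerMX IH mul0r fC0 addr0.
Qed.

Lemma core_set_pure S : pure_core_set S -> core_set S.
Proof.
move=> pS; split=> [B _|f g f0 g0 B SB|f g f0].
- by rewrite horner0.
- by rewrite hornerD hornerN f0// g0// subrr.
have fA A : null_polys (S `&` similarity_class A) f by move=> B [SB _]; exact: f0.
by split=> B SB; have [_ _ /(_ f g (fA B))[gf fg]] := pS B; [apply: gf|apply: fg];
  split=> //; exact: similarity_class_refl.
Qed.

End Similarity.

(** * Union bound for random subsets *)

Lemma prob_random_subset_le1 (R : realType) (T : finType) (E : set T -> Prop) :
  prob_random_subset R E <= 1.
Proof.
rewrite /prob_random_subset ler_pdivrMr ?mul1r ?ler_nat ?max_card//.
by rewrite ltr0n; apply/card_gt0P; exists finset.set0.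
Qed.

Lemma prob_random_subset_le (R : realType) (T : finType)
    (E E' : set T -> Prop) :
  (forall S, E S -> E' S) -> prob_random_subset R E <= prob_random_subset R E'.
Proof.
move=> EE'; rewrite /prob_random_subset ler_wpM2r// ler_nat subset_leq_card//.
by apply/fintype.subsetP => S; rewrite !inE; exact: EE'.
Qed.

(** Sets missing [H i] are the subsets of its complement, at most a fraction [2 ^ -k] of all; the
    bound is multiplied out to stay in the naturals. *)
Lemma card_missing_subsets (T I : finType) (P : pred I) (H : I -> {set T})
    (k : nat) :
  (forall i, P i -> (k <= #|H i|)%N) ->
  (2 ^ k * #|[pred S : {set T} | [exists (i | P i), [disjoint S & H i]]]|
    <= #|I| * #|{set T}|)%N.
Proof.
move=> kH.
apply: (@leq_trans (\sum_(i | P i) 2 ^ k * #|powerset (~: H i)|)%N).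
  rewrite -big_distrr leq_mul2l; apply/orP; right.
  (* Double counting: each missing set lies in at least one of the powersets. *)
  under eq_bigr do rewrite -sum1_card big_mkcond/=.
  rewrite exchange_big -sum1_card big_mkcond/= leq_sum// => S _.
  rewrite inE; case: ifPn => // /existsP[i /andP[Pi Si]].
  by rewrite (bigD1 i)//= inE -finset.disjoints_subset Si leq_addr.
rewrite -sum_nat_const [leqRHS](bigID P)/= (leq_trans _ (leq_addr _ _))//.
apply: leq_sum => i Pi; rewrite card_powerset -expnD.
rewrite -cardsT -powersetT card_powerset cardsT leq_exp2l// -(cardsC (H i)).
by rewrite leq_add2r kH.
Qed.

Lemma prob_random_subset_hitting (R : realType) (T I : finType) (P : pred I)
    (H : I -> {set T}) (k : nat) (E : set T -> Prop) :
  (forall i, P i -> (k <= #|H i|)%N) ->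
  (forall S : {set T}, (forall i, P i -> ~~ [disjoint S & H i]) -> E [set` S]) ->
  1 - #|I|%:R / 2 ^+ k <= prob_random_subset R E.
Proof.
move=> /card_missing_subsets; set m := #|_| => kH hE.
rewrite /prob_random_subset; set a := [pred S : {set T} | _].
have Tgt0 : 0 < #|{set T}|%:R :> R.
  by rewrite ltr0n; apply/card_gt0P; exists finset.set0.
rewrite ler_pdivlMr// mulrBl mul1r lerBlDr mulrAC.
have am : (#|{set T}| <= #|a| + m)%N.
  rewrite -(cardC a) leq_add2l subset_leq_card//; apply/fintype.subsetP => S.
  rewrite !inE; apply: contraR => noS; apply/asboolP/hE => i Pi.
  by apply: contra noS => Si; apply/existsP; exists i; rewrite Pi.
rewrite -(ler_nat R) natrD in am; apply: le_trans am _; rewrite lerD2l.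
by rewrite ler_pdivlMr ?exprn_gt0// mulrC -natrX -!natrM ler_nat.
Qed.

(** * Exponential against polynomial growth *)

(** With [d = K.+1], raise [q <= d * 2 ^ (q %/ d)] to the power [d]. The exponent [K.+1] leaves a
    spare factor [q] for comparing [q ^ K / 2 ^ q] with a harmonic sequence. *)
Lemma expn_le_exp2 (K q : nat) : (q ^ K.+1 <= K.+1 ^ K.+1 * 2 ^ q)%N.
Proof.
have qd : (q <= K.+1 * 2 ^ (q %/ K.+1))%N.
  rewrite (leq_trans (ltnW (ltn_ceil q (ltn0Sn K))))// mulnC leq_mul2l/=.
  exact: ltn_expl.
apply: (@leq_trans ((K.+1 * 2 ^ (q %/ K.+1)) ^ K.+1)%N); first by rewrite leq_exp2r.
by rewrite expnMn leq_mul2l -expnM leq_exp2l// leq_trunc_div orbT.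
Qed.

Lemma cvg_exprn_div_exp2 (R : realType) (K : nat) :
  (fun q : nat => (q ^ K)%:R / 2 ^+ q.-1 : R) @ \oo --> (0 : R).
Proof.
have [C hC] : exists C : R, forall q : nat,
    (q.+1 ^ K)%:R / 2 ^+ q <= C * harmonic q.
  (* The factor 2 pays for the shift from [2 ^ q.+1] to [2 ^ q]. *)
  exists (2 * K.+1 ^ K.+1)%:R => q.
  rewrite /harmonic/= ler_pdivlMr ?ltr0n// mulrAC ler_pdivrMr ?exprn_gt0//.
  rewrite -natrX -!natrM ler_nat -expnSr (leq_trans (expn_le_exp2 _ _))//.
  by rewrite [(2 ^ _.+1)%N]expnS mulnCA mulnA.
rewrite -(cvg_shiftn 1)/=; under eq_fun do rewrite addn1/=.
apply: (@squeeze_cvgr _ _ _ _ (fun=> 0) (fun q => C * harmonic q)).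
- by near=> q; rewrite hC andbT divr_ge0// exprn_ge0.
- exact: cvg_cst.
- by rewrite -[X in _ --> X](mulr0 C); apply: cvgMr; exact: cvg_harmonic.
Unshelve. all: by end_near. Qed.

(** * The bound for random sets of matrices and the limits *)

Lemma prob_pure_core_set_ge (R : realType) (F : finFieldType) (n : nat) :
  (n.+1 < #|F|)%N ->
  1 - (#|F| ^ (n.+1 * n.+1 * n.+2))%:R / 2 ^+ #|F|.-1 <=
  prob_random_subset R (fun S : set 'M[F]_n.+1 => pure_core_set S).
Proof.
(* An index is a matrix and [n.+1] matrix coefficients; with [m = n.+1] this is [m * m * (m + 1)]
   field entries. *)
move=> nF; pose I := ('M[F]_n.+1 * {ffun 'I_n.+1 -> 'M[F]_n.+1})%type.
have -> : (#|F| ^ (n.+1 * n.+1 * n.+2) = #|{: I}|)%N.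
  by rewrite card_prod card_ffun card_ord card_mx -expnS -expnM.
pose poly_of (c : {ffun 'I_n.+1 -> 'M[F]_n.+1}) : {poly 'M[F]_n.+1} :=
  \poly_(k < n.+1) c (inord k).
apply: (@prob_random_subset_hitting R _ I
  (fun i => ~~ is_scalar_mx i.1 && ((poly_of i.2).[i.1] != 0))
  (fun i => [set B | `[< similarity_class i.1 B >]
                   & (poly_of i.2).[B] != 0]%SET)).
  by move=> [A c] /andP[]; exact: card_similarity_nonvanishing.
move=> S hitS; apply: pure_core_set_hitting => // A f szf nsA fA.
pose c : {ffun 'I_n.+1 -> 'M[F]_n.+1} := [ffun k : 'I_n.+1 => f`_k].
have cf : poly_of c = f.
  apply/polyP => k; rewrite coef_poly; case: ltnP => kn.
    by rewrite ffunE inordK.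
  by rewrite nth_default// (leq_trans szf).
have := hitS (A, c); rewrite /= cf nsA fA => /(_ isT).
rewrite -setI_eq0 => /set0Pn[B]; rewrite !inE => /and3P[SB /asboolP AB fB].
by exists B.
Qed.

Theorem theorem1p9 (R : realType) (n : nat) :
  ((fun q : nat =>
      prob_random_subset R (fun S : set 'M['F_q]_n.+1 => pure_core_set S))
     @ within [set q | prime q] \oo --> (1 : R))
  /\
  ((fun q : nat =>
      prob_random_subset R (fun S : set 'M['F_q]_n.+1 => core_set S))
     @ within [set q | prime q] \oo --> (1 : R)).
Proof.
pose lower q : R := 1 - (q ^ (n.+1 * n.+1 * n.+2))%:R / 2 ^+ q.-1.
have lower1 : lower @ within [set q | prime q] \oo --> (1 : R).
  apply: cvg_within_filter.
  suff : lower @ \oo --> (1 - 0 : R) by rewrite subr0.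
  by apply: cvgB; [exact: cvg_cst|exact: cvg_exprn_div_exp2].
(* Primality matters: ['F_q] has [pdiv q] elements, which equals [q] only for prime [q]. *)
have lower_pure q : (n.+1 < q)%N -> prime q -> lower q <=
    prob_random_subset R (fun S : set 'M['F_q]_n.+1 => pure_core_set S).
  move=> nq pq; have := @prob_pure_core_set_ge R 'F_q n.
  by rewrite card_Fp// => /(_ nq).
have large : \forall q \near within [set q | prime q] \oo, (n.+1 < q)%N /\ prime q.
  by near=> q; split; near: q; [apply: cvg_within; exact: nbhs_infty_gt|exact: withinT].
split; apply: (@squeeze_cvgr _ _ _ _ lower (fun=> 1) _ _ _ lower1 (cvg_cst _)); near=> q.
- have [nq pq] : (n.+1 < q)%N /\ prime q by near: q.
  by rewrite lower_pure//= prob_random_subset_le1.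
- have [nq pq] : (n.+1 < q)%N /\ prime q by near: q.
  rewrite prob_random_subset_le1 andbT (le_trans (lower_pure q nq pq))//.
  by apply: prob_random_subset_le => S; exact: core_set_pure.
Unshelve. all: by end_near. Qed.
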